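(* Let $n\ge 1$, $G=GL_n(\mathbb{C})$, $\mathfrak{g}=\mathfrak{gl}_n(\mathbb{C})$, and let $B\subseteq G$ be the subgroup of upper triangular matrices. Let $H=H_\lambda\subseteq\mathfrak{g}$ be a Hessenberg space and let ${}^TH=H_{\lambda^T}$ be the Hessenberg space obtained from $H$ by flipping matrices along the antidiagonal. Then for any $X\in\mathfrak{g}$, the varieties $Hess(X,H)$ and $Hess(X,{}^TH)$ are homeomorphic.
   Context: A (generalized) Hessenberg space is a subspace $H\subseteq\mathfrak{gl}_n(\mathbb{C})$ determined by a non-decreasing function $h:\{1,\dots,n\}\to\{0,1,\dots,n\}$ as $H=\mathrm{span}\{E_{j,i} : 1\le j\le h(i),\ 1\le i\le n\}$, where $E_{j,i}$ is the matrix unit with a $1$ in row $j$, column $i$ (so column $i$ of a matrix in $H$ is arbitrary in rows $1,\dots,h(i)$ and zero below). Equivalently, Hessenberg spaces are indexed by partitions $\lambda=(\lambda_1\ge\lambda_2\ge\dots\ge\lambda_n\ge 0)$ with $\lambda_1\le n$: $H_\lambda$ is the set of matrices whose entry in row $r$, column $c$ is zero whenever $c\le\lambda_{n+1-r}$ (the forced zeros form the Young diagram of $\lambda$ in French notation, placed in the lower left corner). $\lambda^T$ denotes the conjugate (transposed) partition. The flip of an $n\times n$ matrix $M$ along its antidiagonal is ${}^TM=w_0M^Tw_0$, where $M^T$ is the transpose and $w_0$ is the permutation matrix with ones on the antidiagonal; ${}^TH=\{{}^TM: M\in H\}$, which equals $H_{\lambda^T}$ when $H=H_\lambda$. For $X\in\mathfrak{g}$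 and a Hessenberg space $H$, the Hessenberg variety is $Hess(X,H)=\{gB\in G/B : g^{-1}Xg\in H\}$, a subspace of $G/B$. *)

(* Defs.v *)
From HB Require Import structures.
From mathcomp Require Import all_boot all_order all_algebra.
From mathcomp Require Import all_classical all_reals all_analysis.
From mathcomp Require Import complex.
Set Implicit Arguments.
Unset Strict Implicit.
Unset Printing Implicit Defensive.
Import Order.TTheory GRing.Theory Num.Theory.
Import numFieldNormedType.Exports.
Local Open Scope classical_set_scope.
Local Open Scope ring_scope.

(* The complex numbers over [R], packed as a [numClosedFieldType] so that the
   instances of [numFieldNormedType] apply: [CC R] carries the Euclidean
   topology given by the complex modulus, and matrices over it the entrywise
   (product) topology. *)
Definition CC (R : realType) : numClosedFieldType := R[i]%C.

Definition homeomorphic (S T : topologicalType) : Prop :=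
  exists (f : S -> T) (g : T -> S),
    [/\ continuous f, continuous g, cancel f g & cancel g f].

(* All indices are 0-based: for [i : 'I_n], [lam i] is the part
   $\lambda_{i+1}$. *)
Definition boxed_partition (n : nat) (lam : 'I_n -> nat) : Prop :=
  (forall i j : 'I_n, (i <= j)%N -> (lam j <= lam i)%N) /\
  (forall i : 'I_n, (lam i <= n)%N).

Definition conjugate_partition (n : nat) (lam : 'I_n -> nat) : 'I_n -> nat :=
  fun j => #|[set i : 'I_n | (j < lam i)%N]%SET|.

(* In 1-based indices the entry $(r, c)$ vanishes whenever
   $c \le \lambda_{n+1-r}$; [rev_ord] is $r \mapsto n+1-r$. *)
Definition hessenberg_space (R : realType) (n : nat) (lam : 'I_n -> nat) :
    set 'M[CC R]_n :=
  [set M | forall r c : 'I_n, (c < lam (rev_ord r))%N -> M r c = 0].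

Definition antidiag_mx (R : realType) (n : nat) : 'M[CC R]_n :=
  \matrix_(i, j) (j == rev_ord i)%:R.

Definition flip_mx (R : realType) (n : nat) (M : 'M[CC R]_n) : 'M[CC R]_n :=
  antidiag_mx R n *m M^T *m antidiag_mx R n.

Section FlagVariety.
Variables (R : realType) (n : nat).

(* [set_type] carries the topology induced from ['M[CC R]_n]. *)
Definition GL : topologicalType :=
  set_type [set g : 'M[CC R]_n | g \in unitmx].

Definition GLmx (g : GL) : 'M[CC R]_n := set_val g.

Definition borel : set GL :=
  [set b | forall i j : 'I_n, (j < i)%N -> GLmx b i j = 0].

Definition borel_coset (g : GL) : set GL :=
  [set x | exists2 b : GL, borel b &
     GLmx x = GLmx g *m GLmx b].

Definition same_coset : rel GL := fun g h => `[< borel_coset g = borel_coset h >].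

Lemma same_coset_refl : reflexive same_coset.
Proof. by move=> g; apply/asboolP. Qed.

Lemma same_coset_sym : symmetric same_coset.
Proof. by move=> g h; apply/asboolP/asboolP. Qed.

Lemma same_coset_trans : transitive same_coset.
Proof.
by move=> h g k /asboolP gh /asboolP hk; apply/asboolP; rewrite gh.
Qed.

Canonical same_coset_equiv :=
  EquivRel same_coset same_coset_refl same_coset_sym same_coset_trans.

(* $G/B$ with the quotient topology. *)
Definition flag_quot := {eq_quot same_coset}%qT.

Definition flag_variety : topologicalType := quotient_topology flag_quot.

Definition flag_proj (g : GL) : flag_variety := (\pi_flag_quot g)%qT.

Definition Hess (X : 'M[CC R]_n) (H : set 'M[CC R]_n) : set flag_variety :=
  flag_proj @` [set g : GL |
    H (invmx (GLmx g) *m X *m GLmx g)].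

End FlagVariety.

Lemma flip_mxE (R : realType) (n : nat) (M : 'M[CC R]_n) (i j : 'I_n) :
  flip_mx M i j = M (rev_ord j) (rev_ord i).
Proof.
rewrite /flip_mx mxE (bigD1 (rev_ord j)) //= big1 => [|k kj]; last first.
  rewrite [X in _ * X]mxE (_ : (j == rev_ord k) = false) ?mulr0 //.
  by apply: contra_neqF kj => /eqP ->; rewrite rev_ordK.
rewrite addr0 [X in _ * X]mxE rev_ordK eqxx mulr1.
rewrite mxE (bigD1 (rev_ord i)) //= big1 => [|k ki]; last first.
  by rewrite mxE (negbTE ki) mul0r.
by rewrite addr0 !mxE eqxx mul1r.
Qed.

Lemma conjugate_partitionP (n : nat) (lam : 'I_n -> nat) (i j : 'I_n) :
  boxed_partition lam -> (i < conjugate_partition lam j)%N = (j < lam i)%N.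
Proof.
move=> [lam_noninc _].
have cardlt m : (m <= n)%N -> #|[set k : 'I_n | (k < m)%N]%SET| = m.
  move=> lemn; have wI : injective (widen_ord lemn).
    by move=> k l /(congr1 val) kl; exact: val_inj.
  rewrite -[RHS]card_ord -(card_imset predT wI).
  apply: eq_card => k; rewrite inE; apply/idP/imsetP => [km|[l _ ->]] //=.
  by exists (Ordinal km) => //; apply: val_inj.
rewrite /conjugate_partition; case: (ltnP j (lam i)) => jlam.
  rewrite -[X in (X <= _)%N]cardlt //; apply: subset_leq_card.
  apply/fintype.subsetP => k; rewrite !inE ltnS => ki.
  exact: leq_trans jlam (lam_noninc _ _ ki).
apply/negbTE; rewrite -leqNgt -[X in (_ <= X)%N]cardlt; last exact: ltnW.
apply: subset_leq_card; apply/fintype.subsetP => k; rewrite !inE => jk.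
rewrite ltnNge; apply/negP => ik.
by have := leq_trans jk (leq_trans (lam_noninc _ _ ik) jlam); rewrite ltnn.
Qed.

Lemma conjugate_boxed (n : nat) (lam : 'I_n -> nat) :
  boxed_partition lam -> boxed_partition (conjugate_partition lam).
Proof.
move=> _; split=> [i j ij|i].
  apply: subset_leq_card; apply/fintype.subsetP => k; rewrite !inE.
  exact: leq_ltn_trans.
by rewrite -[X in (_ <= X)%N]card_ord; exact: max_card.
Qed.

(* ${}^T H_\lambda = H_{\lambda^T}$ *)
Lemma flip_hessenberg_space (R : realType) (n : nat) (lam : 'I_n -> nat) :
  boxed_partition lam ->
  @flip_mx R n @` hessenberg_space lam =
  hessenberg_space (conjugate_partition lam).
Proof.
move=> lamP; apply/seteqP; split=> [_ [M MH <-] r c|M MH].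
  by rewrite conjugate_partitionP // flip_mxE => ?; apply: MH; rewrite rev_ordK.
exists (flip_mx M) => [r c rc|]; last first.
  by apply/matrixP => i j; rewrite !flip_mxE !rev_ordK.
by rewrite flip_mxE; apply: MH; rewrite rev_ordK conjugate_partitionP.
Qed.

(* Main.v *)
(* A complex matrix X is similar to its transpose: X S = S X^T for some
   invertible S. Then g |-> S g^-T w0 induces a homeomorphism of G/B, with
   inverse g |-> S^T g^-T w0, and it replaces g^-1 X g by its flip along the
   antidiagonal.

   S is found by induction on the size. Let (x - a)^(k+1) be the exact power of
   x - a dividing the minimal polynomial q (x - a)^(k+1) of X, put N = X - a,
   and pick i, j such that the (i, j) entry of q(X) N^k q(X) is nonzero. The
   rows e_i q(X) N^b and the columns N^b q(X) e_j, b <= k, pair to an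
   invertible Hankel matrix, which splits off a cyclic block and takes it to
   its transpose. *)
Require Import Defs.
From mathcomp Require Import all_boot all_order all_algebra.
From mathcomp Require Import all_classical all_reals all_analysis.
Set Implicit Arguments.
Unset Strict Implicit.
Unset Printing Implicit Defensive.
Import GRing.Theory.
Import numFieldNormedType.Exports.
Local Open Scope classical_set_scope.
Local Open Scope ring_scope.

(** * Similarity of a matrix to its transpose *)

Section TransposeSimilarity.
Variable F : fieldType.

(** Reversing the order of the rows yields a lower triangular matrix [L] with every diagonal entry
    equal to [h k]. *)
Lemma unitmx_hankel k (h : nat -> F) :
  h k != 0 -> (forall a, (k < a)%N -> h a = 0) ->
  \matrix_(i < k.+1, j < k.+1) h (i + j)%N \in unitmx.
Proof.
move=> hk h0; set H := \matrix_(i, j) _.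
pose L := \matrix_(i < k.+1) row (rev_ord i) H.
have Lij i j : L i j = h (k - i + j)%N by rewrite !mxE /= subSS.
have detL : \det L != 0.
  rewrite det_trig; last first.
    apply/is_trig_mxP => i j ij; rewrite Lij h0 //.
    have ik : (i <= k)%N by rewrite -ltnS.
    by rewrite -{1}(subnK ik) ltn_add2l.
  rewrite (eq_bigr (fun=> h k)) => [|i _]; last by rewrite Lij subnK // -ltnS.
  by rewrite prodr_const expf_neq0.
have LE : L = (\matrix_(i < k.+1) row (rev_ord i) 1%:M) *m H.
  by apply/row_matrixP => i; rewrite row_mul !rowK -row_mul mul1mx.
by rewrite unitmxE unitfE; apply: contraNneq detL => H0;
  rewrite LE det_mulmx H0 mulr0.
Qed.

(** In the rank factorization [Q = C A], [C] has a left inverse and [A] a right inverse; cancelling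
    them in [C A C A = C A] leaves [A C = 1]. *)
Lemma idempotent_base n (Q : 'M[F]_n) : Q *m Q = Q ->
  exists (C : 'M[F]_(n, \rank Q)) (A : 'M[F]_(\rank Q, n)),
    C *m A = Q /\ A *m C = 1%:M.
Proof.
move=> QQ; exists (col_base Q), (row_base Q); split; first exact: mulmx_base.
have := mulmx_base Q; have := row_base_free Q; have := col_base_full Q.
move: (\rank Q) (col_base Q) (row_base Q) => r C A.
move=> /row_fullP[C' CC'] /row_freeP[A' AA'] CA.
have -> : A *m C = C' *m (C *m A *m (C *m A)) *m A'.
  by rewrite -[LHS]mul1mx -CC' -[LHS]mulmx1 -AA' !mulmxA.
by rewrite CA QQ -CA -!mulmxA AA' mulmx1.
Qed.

Definition symmetrizer n (X S : 'M[F]_n) := S \in unitmx /\ X *m S = S *m X^T.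

(** With [H = U V], the matrix [P = V H^-1 U] is a projection commuting with [X]. The summand
    [V H^-1 V^T] handles its image; the complement [Q = 1 - P = C A] is handled by induction,
    applied to the compression [A X C]. *)
Lemma symmetrizer_split n k (X : 'M[F]_n) (U : 'M[F]_(k, n)) (V : 'M[F]_(n, k))
    (J : 'M[F]_k) :
  U *m X = J *m U -> X *m V = V *m J^T -> U *m V \in unitmx -> (0 < k)%N ->
  (forall m (Y : 'M[F]_m), (m < n)%N -> exists S, symmetrizer Y S) ->
  exists S, symmetrizer X S.
Proof.
move=> UX XV; set H := U *m V => Hu k0 IH.
pose P := V *m invmx H *m U; pose Q := 1%:M - P.
have PV : P *m V = V by rewrite -!mulmxA mulVmx // mulmx1.
have UP : U *m P = U by rewrite !mulmxA mulmxV // mul1mx.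
have QV : Q *m V = 0 by rewrite mulmxBl PV mul1mx subrr.
have UQ : U *m Q = 0 by rewrite mulmxBr UP mulmx1 subrr.
have HJ : J^T *m invmx H = invmx H *m J.
  have HJ : H *m J^T = J *m H by rewrite -mulmxA -XV !mulmxA UX.
  by rewrite -[LHS](mulKmx Hu) (mulmxA H) HJ mulmxK.
have XP : X *m P = P *m X.
  by rewrite !mulmxA XV -(mulmxA V) HJ -!mulmxA UX.
have XQ : X *m Q = Q *m X by rewrite mulmxBl mulmxBr XP mulmx1 mul1mx.
have QQ : Q *m Q = Q.
  by rewrite {1}/Q mulmxBl mul1mx -!mulmxA UQ !mulmx0 subr0.
have rQ : (\rank Q < n)%N.
  rewrite ltn_neqAle rank_leq_row andbT; apply/negP => /row_fullP[Q' Q'Q].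
  have V0 : V = 0 by rewrite -[V]mul1mx -Q'Q -mulmxA QV mulmx0.
  move: Hu; rewrite /H V0 mulmx0 unitmxE; case: (k) k0 => // k' _.
  by rewrite det0 unitr0.
move: (\rank Q) rQ (idempotent_base QQ) => m rQ [C [A [CA AC]]].
have AQ : A *m Q = A by rewrite -CA mulmxA AC mul1mx.
have QC : Q *m C = C by rewrite -CA -mulmxA AC mulmx1.
have AV : A *m V = 0 by rewrite -AQ -mulmxA QV mulmx0.
have UC : U *m C = 0 by rewrite -QC mulmxA UQ mul0mx.
have [S' [S'u YS']] := IH _ (A *m X *m C) rQ.
have XC : X *m C = C *m (A *m X *m C) by rewrite !mulmxA CA -XQ -mulmxA QC.
pose S := V *m invmx H *m V^T + C *m S' *m C^T.
exists S; split.
  (* Since [A V = 0] and [U C = 0], the cross terms of [S Z] vanish and the rest is [P + Q = 1]. *)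
  pose Z := U^T *m (invmx H)^T *m U + A^T *m invmx S' *m A.
  suff /mulmx1_unit[] : S *m Z = 1%:M by [].
  have VU : V^T *m U^T = H^T by rewrite -trmx_mul.
  have CAt : C^T *m A^T = 1%:M by rewrite -trmx_mul AC trmx1.
  have VA : V^T *m A^T = 0 by rewrite -trmx_mul AV trmx0.
  have CU : C^T *m U^T = 0 by rewrite -trmx_mul UC trmx0.
  rewrite /Z mulmxDr !mulmxDl -!mulmxA.
  rewrite !(mulmxA V^T) !(mulmxA C^T) VU CAt VA CU.
  rewrite !(mul0mx, mulmx0) addr0 add0r mul1mx (mulmxA H^T) -trmx_mul.
  rewrite mulVmx // trmx1 mul1mx (mulmxA S') mulmxV // mul1mx CA mulmxA.
  by rewrite addrC subrK.
rewrite mulmxDr mulmxDl; congr (_ + _).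
  rewrite !mulmxA XV -(mulmxA V) HJ -!(mulmxA _ _ X^T) -trmx_mul XV.
  by rewrite trmx_mul trmxK !mulmxA.
rewrite -!mulmxA -[C^T *m X^T]trmx_mul XC trmx_mul (mulmxA X) XC.
by rewrite (mulmxA S') -YS' !mulmxA.
Qed.

End TransposeSimilarity.

Lemma symmetrizer_exists (F : closedFieldType) n (X : 'M[F]_n) :
  exists S, symmetrizer X S.
Proof.
elim/ltn_ind: n => -[|n] IH in X *.
  by exists 1%:M; split; [exact: unitmx1 | apply/matrixP => -[]].
pose p := mxminpoly X.
have p_neq0 : p != 0 by rewrite monic_neq0 // mxminpoly_monic.
have [a pa] : exists a, root p a.
  apply/closed_rootP; rewrite size_mxminpoly eqSS -lt0n.
  exact: mxminpoly_nonconstant.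
have [[|k] [q + pE]] := multiplicity_XsubC p a; rewrite p_neq0 /= => qa.
  by move: pa; rewrite pE mulr1 (negbTE qa).
pose N := X - a%:M; pose qX := horner_mx X q.
have NE : horner_mx X ('X - a%:P) = N.
  by rewrite rmorphB /= horner_mx_X horner_mx_C.
have qN : qX * N = N * qX by rewrite -NE -!rmorphM mulrC.
have qNXn b : qX * N ^+ b = N ^+ b * qX by exact: commrX.
have qN0 b : (k < b)%N -> qX * N ^+ b = 0.
  move=> kb; rewrite -(subnKC kb) exprD mulrA.
  suff -> : qX * N ^+ k.+1 = 0 by rewrite mul0r.
  by rewrite -NE -rmorphXn -rmorphM -pE; exact: mx_root_minpoly.
(* Otherwise [p = q (x - a)^(k+1)] divides [q (x - a)^k q], so [x - a] divides [q], against the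
   choice of the multiplicity. *)
have qNqN0 : qX * N ^+ k * qX != 0.
  rewrite -NE -rmorphXn -!rmorphM /=; apply: contraNneq qa => /mxminpoly_min.
  have r_neq0 : q * ('X - a%:P) ^+ k != 0.
    by apply: contraNneq p_neq0; rewrite pE exprSr mulrA => ->; rewrite mul0r.
  by rewrite -/p pE exprSr mulrA dvdp_mul2l // dvdp_XsubCl.
have [i [j qij]] : exists i j, (qX * N ^+ k * qX) i j != 0.
  by move/matrix0Pn: qNqN0.
(* Row [b] of [U] times column [c] of [V] is [h (b + c)]: hence the two factors [qX]. *)
pose h b := (qX * N ^+ b * qX) i j.
pose U := \matrix_(b < k.+1) row i (qX * N ^+ b).
pose V := (\matrix_(b < k.+1) (col j (N ^+ b * qX))^T)^T.
(* A Jordan block: [N] sends each row of [U] to the next and the last to 0, because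
   [qX * N ^+ k.+1 = 0]. *)
pose J := a%:M + \matrix_(b < k.+1, c < k.+1) (c == b.+1 :> nat)%:R.
have UE (b : 'I_k.+1) c : U b c = (qX * N ^+ b) i c by rewrite !mxE.
have VE c (b : 'I_k.+1) : V c b = (N ^+ b * qX) c j by rewrite !mxE.
(* [insub b.+1] fails exactly at the last row, which has no successor; the default 0 matches
   [qN0]. *)
have JE (D : 'M[F]_(k.+1, n.+1)) (b : 'I_k.+1) c :
  (J *m D) b c = a * D b c + (if insub b.+1 is Some b' then D b' c else 0).
  rewrite mulmxDl mul_scalar_mx 2!mxE; congr (_ + _); rewrite mxE.
  under eq_bigr do rewrite mxE mulr_natl mulrb.
  rewrite -big_mkcond /=; case: insubP => [b' _ b'E|b_max].
    by rewrite (big_pred1 b') // => d; rewrite -b'E.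
  by rewrite big_pred0 // => d; apply: contraNF b_max => /eqP <-.
have XE : X = a%:M + N by rewrite addrC subrK.
apply: (@symmetrizer_split _ _ _ _ U V J) => //.
- apply/matrixP => b c; rewrite JE XE mulmxDr mul_mx_scalar 2!mxE.
  congr (_ + _).
  transitivity ((qX * N ^+ b.+1) i c).
    rewrite exprSr mulrA [in RHS]mxE mxE; apply: eq_bigr => d _.
    by rewrite UE.
  case: insubP => [b' _ <-|]; first by rewrite UE.
  by rewrite -leqNgt => kb; rewrite qN0 // mxE.
(* Transposing turns [V J^T] into [J V^T], so that [JE] applies again. *)
- apply: trmx_inj; apply/matrixP => b c.
  rewrite [in RHS]trmx_mul trmxK JE XE mulmxDl mul_scalar_mx.
  rewrite [LHS]mxE [LHS]mxE [X in X + _]mxE [V^T b c]mxE; congr (_ + _).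
  transitivity ((N ^+ b.+1 * qX) c j).
    rewrite exprS -mulrA [in RHS]mxE mxE; apply: eq_bigr => d _.
    by rewrite VE.
  case: insubP => [b' _ <-|]; first by rewrite [RHS]mxE VE.
  by rewrite -leqNgt => kb; rewrite -qNXn qN0 // mxE.
- rewrite (_ : U *m V = \matrix_(b, c) h (b + c)%N).
    by apply: unitmx_hankel => // b kb; rewrite /h qN0 // mul0r mxE.
  apply/matrixP => b c; rewrite [RHS]mxE /h exprD mulrA -mulrA !mxE.
  by apply: eq_bigr => d _; rewrite UE VE.
- by move=> m Y mn; exact: IH.
Qed.

(** * Continuity of matrix operations, and restriction of homeomorphisms to subspaces *)

Section MatrixContinuity.
Variables (K : numFieldType) (T : topologicalType).

Lemma continuous_mx m n (f : T -> 'M[K]_(m, n)) :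
  (forall i j, continuous (fun t => f t i j)) -> continuous f.
Proof.
move=> fc t U [P Pn PU].
suff : \forall s \near t, forall i j, P i j (f s i j).
  by apply: filterS => s /PU.
by apply: filter_forall => i; apply: filter_forall => j; exact: fc (Pn i j).
Qed.

Lemma continuous_mxE m n (f : T -> 'M[K]_(m, n)) i j :
  continuous f -> continuous (fun t => f t i j).
Proof.
move=> fc t; apply: (@continuous_comp _ _ _ f (fun M => M i j)).
  exact: fc.
exact: coord_continuous.
Qed.

Lemma continuous_mulmx m n p (f : T -> 'M[K]_(m, n)) (g : T -> 'M[K]_(n, p)) :
  continuous f -> continuous g -> continuous (fun t => f t *m g t).
Proof.
move=> fc gc; apply: continuous_mx => i j.
under [X in continuous X]eq_fun do rewrite mxE.
apply: continuous_big => [|k _ t]; first exact: add_continuous.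
by apply: continuousM; exact: continuous_mxE.
Qed.

Lemma continuous_trmx m n (f : T -> 'M[K]_(m, n)) :
  continuous f -> continuous (fun t => (f t)^T).
Proof.
move=> fc; apply: continuous_mx => i j.
under [X in continuous X]eq_fun do rewrite mxE.
exact: continuous_mxE.
Qed.

Lemma continuous_det n (f : T -> 'M[K]_n) :
  (forall i j, continuous (fun t => f t i j)) ->
  continuous (fun t => \det (f t)).
Proof.
move=> fc; apply: continuous_big => [|s _ t]; first exact: add_continuous.
apply: (@continuousM _ _ (fun=> _)
  (fun u => \prod_i f u i (perm.fun_of_perm s i))).
  exact: cst_continuous.
by apply: continuous_big => [|i _]; [exact: mul_continuous | exact: fc].
Qed.

(** By Cramer's rule the entries are cofactors divided by a determinant that never vanishes. *)
Lemma continuous_invmx n (f : T -> 'M[K]_n) :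
  continuous f -> (forall t, f t \in unitmx) ->
  continuous (fun t => invmx (f t)).
Proof.
move=> fc fu.
rewrite (_ : (fun t => _) = fun t => (\det (f t))^-1 *: \adj (f t)); last first.
  by apply/funext => t; rewrite /invmx fu.
apply: continuous_mx => i j.
under [X in continuous X]eq_fun do rewrite 2!mxE.
move=> t; apply: (@continuousM _ _ (fun u => (\det (f u))^-1)
  (fun u => cofactor (f u) j i)).
  apply: continuousV; first by rewrite -unitfE -unitmxE.
  by apply: continuous_det => k l; exact: continuous_mxE.
apply: (@continuousM _ _ (fun=> _) (fun u => \det (row' j (col' i (f u))))).
  exact: cst_continuous.
apply: continuous_det => k l.
under [X in continuous X]eq_fun do rewrite 2!mxE.
exact: continuous_mxE.
Qed.

End MatrixContinuity.

Lemma homeomorphic_subset (T : topologicalType) (A B : set T) (f g : T -> T) :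
  continuous f -> continuous g -> cancel f g -> cancel g f ->
  (forall x, A x -> B (f x)) -> (forall x, B x -> A (g x)) ->
  homeomorphic (set_type A) (set_type B).
Proof.
move=> fc gc fK gK AB BA.
pose F (x : A) : B := exist _ (f (set_val x)) (mem_set (AB _ (set_valP x))).
pose G (x : B) : A := exist _ (g (set_val x)) (mem_set (BA _ (set_valP x))).
exists F, G; split.
- apply: continuous_comp_initial => x.
  apply: (@continuous_comp _ _ _ set_val f); last exact: fc.
  exact: initial_continuous.
- apply: continuous_comp_initial => x.
  apply: (@continuous_comp _ _ _ set_val g); last exact: gc.
  exact: initial_continuous.
- by move=> x; apply: val_inj; exact: fK.
- by move=> x; apply: val_inj; exact: gK.
Qed.

(** * The duality of the flag variety attached to an invertible matrix *)

Section FlagDuality.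
Variables (R : realType) (n : nat).
Local Notation w0 := (antidiag_mx R n).
Implicit Types (g h b c : GL R n) (S X : 'M[CC R]_n).

Lemma GLmx_unit g : GLmx g \in unitmx.
Proof. exact: (set_valP g). Qed.

Lemma GLmx_inj : injective (@GLmx R n).
Proof. exact: val_inj. Qed.

Lemma GLmx_continuous : continuous (@GLmx R n).
Proof. exact: initial_continuous. Qed.

Definition GL_of S (Su : S \in unitmx) : GL R n := exist _ S (mem_set Su).

Lemma flip_mxK : involutive (@flip_mx R n).
Proof. by move=> M; apply/matrixP => i j; rewrite !flip_mxE !rev_ordK. Qed.

Lemma antidiag_tr : w0^T = w0.
Proof.
by apply/matrixP => i j; rewrite !mxE eq_sym (can2_eq rev_ordK rev_ordK).
Qed.

Lemma antidiag_mxK : w0 *m w0 = 1%:M.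
Proof.
(* The product is read as the flip of the identity matrix. *)
rewrite -[X in X *m _]mulmx1 -trmx1; apply/matrixP => i j.
by rewrite flip_mxE !mxE (inj_eq rev_ord_inj) eq_sym.
Qed.

Lemma antidiag_unit : w0 \in unitmx.
Proof. by have /mulmx1_unit[] := antidiag_mxK. Qed.

Lemma flip_mx_unit (M : 'M[CC R]_n) : M \in unitmx -> flip_mx M \in unitmx.
Proof. by move=> Mu; rewrite !unitmx_mul unitmx_tr Mu antidiag_unit. Qed.

Lemma borel_coset_self g : borel_coset g g.
Proof.
exists (GL_of (unitmx1 _ _)); last by rewrite mulmx1.
by move=> i j ji; rewrite mxE; case: eqVneq ji => // ->; rewrite ltnn.
Qed.

Lemma borel_coset_sub g h : borel_coset g h -> borel_coset h `<=` borel_coset g.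
Proof.
move=> [b bB hE] x [c cB xE].
have bcu : GLmx b *m GLmx c \in unitmx by rewrite unitmx_mul !GLmx_unit.
exists (GL_of bcu); last by rewrite xE hE mulmxA.
move=> i j ji; rewrite mxE big1 // => k _.
have [ki|ik] := ltnP k i; first by rewrite bB ?mul0r.
by rewrite cB ?mulr0 // (leq_trans ji).
Qed.

Lemma flag_projP g h :
  reflect (borel_coset g = borel_coset h) (flag_proj g == flag_proj h).
Proof.
apply: (iffP eqP) => [/(eqmodP (same_coset_equiv R n) g h)/asboolP //|gh].
by apply/(eqmodP (same_coset_equiv R n) g h)/asboolP.
Qed.

Section Dual.
Variables (S : 'M[CC R]_n) (Su : S \in unitmx).

Lemma dual_unit g : S *m (invmx (GLmx g))^T *m w0 \in unitmx.
Proof.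
by rewrite !unitmx_mul Su antidiag_unit unitmx_tr unitmx_inv GLmx_unit.
Qed.

(** The columns of [g^-T] form the dual basis, and [w0] reverses their order: a flag goes to the
    flag of its annihilators, moved by [S]. *)
Definition dual g : GL R n := GL_of (dual_unit g).

Lemma GLmx_dual g : GLmx (dual g) = S *m (invmx (GLmx g))^T *m w0.
Proof. by []. Qed.

Lemma dual_continuous : continuous dual.
Proof.
apply: continuous_comp_initial.
have cstC (M : 'M[CC R]_n) : continuous (fun _ : GL R n => M).
  exact: cst_continuous.
apply: continuous_mulmx => //; apply: continuous_mulmx => //.
apply: continuous_trmx; apply: continuous_invmx; first exact: GLmx_continuous.
exact: GLmx_unit.
Qed.

(* If g = h c, then dual h = dual g * flip c. *)
Lemma dual_coset g h : borel_coset h g -> borel_coset (dual g) (dual h).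
Proof.
move=> [c cB gE]; exists (GL_of (flip_mx_unit (GLmx_unit c))).
  move=> i j ji; rewrite flip_mxE cB //= ltn_sub2l //.
  by rewrite (leq_ltn_trans _ (ltn_ord i)).
have hV : invmx (GLmx h) = GLmx c *m invmx (GLmx g).
  rewrite -[LHS]mulmx1 -(mulmxV (GLmx_unit g)) [in X in _ *m (X *m _)]gE.
  by rewrite !mulmxA mulVmx ?mul1mx // GLmx_unit.
rewrite !GLmx_dual hV trmx_mul [GLmx (GL_of _)]/(flip_mx _) /flip_mx.
rewrite !mulmxA; congr (_ *m _ *m _).
by rewrite -[in RHS](mulmxA _ w0) antidiag_mxK mulmx1.
Qed.

Definition flag_dual (x : flag_variety R n) : flag_variety R n :=
  flag_proj (dual (repr x)).

(** Equal cosets give both [g] in [hB] and [h] in [gB]; each membership dualizes to one of the two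
    inclusions, so triangular matrices are never inverted. *)
Lemma flag_dual_homo g h :
  flag_proj g == flag_proj h -> flag_proj (dual g) == flag_proj (dual h).
Proof.
move=> /flag_projP gh; apply/flag_projP; apply/seteqP.
split; apply: borel_coset_sub; apply: dual_coset.
  by rewrite gh; exact: borel_coset_self.
by rewrite -gh; exact: borel_coset_self.
Qed.

Lemma flag_dual_proj g : flag_dual (flag_proj g) = flag_proj (dual g).
Proof.
apply/eqP; apply: flag_dual_homo; apply/eqP; exact: reprK.
Qed.

Lemma flag_dual_continuous : continuous flag_dual.
Proof.
apply: (@repr_comp_continuous _ _ _ (fun g => flag_proj (dual g))).
  move=> g; apply: continuous_comp; first exact: dual_continuous.
  exact: pi_continuous.
exact: flag_dual_homo.
Qed.

(** For [D = S g^-T w0], the relation [X S = S X^T] gives [X D = S X^T g^-T w0 = D w0 (g^-1 X g)^T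
    w0], so [D^-1 X D] is the flip of [g^-1 X g]. *)
Lemma flag_dual_Hess X (H : set 'M[CC R]_n) (x : flag_variety R n) :
  X *m S = S *m X^T -> Hess X H x -> Hess X (@flip_mx R n @` H) (flag_dual x).
Proof.
move=> XS [g gH <-]; rewrite flag_dual_proj; exists (dual g) => //=.
exists (invmx (GLmx g) *m X *m GLmx g) => //.
rewrite GLmx_dual; set gX := invmx _ *m X *m _.
rewrite -[RHS]mulmxA; apply: (canRL (mulKmx (dual_unit g))).
rewrite /flip_mx !mulmxA -(mulmxA _ w0 w0) antidiag_mxK mulmx1.
by rewrite -(mulmxA S) -trmx_mul mulmxK ?GLmx_unit // trmx_mul !mulmxA XS.
Qed.

End Dual.

(** Transposing [D = S g^-T w0] gives [S^T = g w0 D^T], whence [S^T D^-T w0 = g]. Stating [S' = S^T]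
    as an equation also covers the reverse composite, where [S'] is [S] and [S] is [S^T]. *)
Lemma dualK S S' (Su : S \in unitmx) (S'u : S' \in unitmx) :
  S' = S^T -> cancel (dual Su) (dual S'u).
Proof.
move=> S'E g; apply: GLmx_inj; rewrite !GLmx_dual S'E.
move: (dual_unit Su g); set D := S *m _ *m w0; rewrite -unitmx_tr => Du.
have -> : S^T = GLmx g *m w0 *m D^T.
  rewrite !trmx_mul trmxK antidiag_tr !mulmxA -(mulmxA _ w0 w0) antidiag_mxK.
  by rewrite mulmx1 mulmxV ?GLmx_unit // mul1mx.
by rewrite trmx_inv mulmxK // -mulmxA antidiag_mxK mulmx1.
Qed.

Lemma flag_dualK S S' (Su : S \in unitmx) (S'u : S' \in unitmx) :
  S' = S^T -> cancel (flag_dual Su) (flag_dual S'u).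
Proof.
by move=> S'E x; rewrite flag_dual_proj dualK //; exact: reprK.
Qed.

End FlagDuality.

Theorem theorem18 (R : realType) (n : nat) (n_gt0 : (1 <= n)%N)
    (lam : 'I_n -> nat) (lam_part : boxed_partition lam) (X : 'M[CC R]_n) :
  homeomorphic
    (set_type (Hess X (hessenberg_space lam)))
    (set_type (Hess X (@flip_mx R n @` hessenberg_space lam))).
Proof.
have [S [Su XS]] := symmetrizer_exists X.
have Stu : S^T \in unitmx by rewrite unitmx_tr.
(* The inverse map is the dual for [S^T], so [S^T] must intertwine [X] and [X^T] as well. *)
have XSt : X *m S^T = S^T *m X^T by rewrite -trmx_mul XS trmx_mul trmxK.
apply: (@homeomorphic_subset _ _ _ (flag_dual Su) (flag_dual Stu)).
- exact: flag_dual_continuous.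
- exact: flag_dual_continuous.
- exact: flag_dualK.
- by apply: flag_dualK; rewrite trmxK.
- by move=> x; exact: flag_dual_Hess.
(* The reverse map lands in the variety of the twice flipped space, which is the original one. *)
- move=> x /(flag_dual_Hess Stu XSt); rewrite image_comp.
  by under eq_imagel do rewrite /= flip_mxK; rewrite image_id.
Qed.
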